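(* For every real number $h\geq h_1$ and every $\varepsilon>0$, there exist a real number $h'$ with $|h'-h|<\varepsilon$ and an infinite sequence $(Q_k)_{k\in\mathbb{N}}$ of quadratic forms such that $h_{Q_k}=h'$ for all $k$, and such that the sets of terms $\{Q_k(x):x\in\mathbb{N}\}$, $k\in\mathbb{N}$, are pairwise disjoint.
   Context: Here a quadratic form is a polynomial $Q=aX^2+bX+c$ with integer coefficients, $a\neq 0$, and $\mathbb{N}$ contains $0$. For a prime $p$ let $t_p(Q)=|\{x\in\mathbb{F}_p : Q(x)\equiv 0 \ [p]\}|$, and $$h_Q=\prod_{p \text{ odd prime}}\frac{p-t_p(Q)}{p-1},$$ the infinite product being taken as the limit as $N\to\infty$ of the partial products over odd primes $p\leq N$. The constant $h_1$ denotes $h_{(2X)^2+1}$, i.e. $h_1=\prod_{p\text{ odd prime}}\frac{p-t_p}{p-1}$ with $t_p=2$ if $p\equiv 1\ [4]$ and $t_p=0$ if $p\equiv 3\ [4]$. *)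

(* Defs.v *)
From HB Require Import structures.
From mathcomp Require Import all_boot all_order all_algebra.
From mathcomp Require Import all_classical all_reals all_analysis.

Set Implicit Arguments.
Unset Strict Implicit.
Unset Printing Implicit Defensive.

Import Order.TTheory GRing.Theory Num.Theory.
Import numFieldNormedType.Exports.

Local Open Scope classical_set_scope.
Local Open Scope ring_scope.

Definition quadratic_form (Q : {poly int}) : Prop := size Q = 3%N.

(* Meaningful for [p] prime only: ['F_p] is then the field with [p] elements. *)
Definition nroots_mod (p : nat) (Q : {poly int}) : nat :=
  #|[pred x : 'F_p | root (map_poly intr Q) x]|.

Definition h_partial (R : realType) (Q : {poly int}) (N : nat) : R :=
  \prod_(p < N.+1 | prime p && odd p)
    ((p%:R - (nroots_mod p Q)%:R) / (p%:R - 1)).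

(* [limn] is total: this is the infinite product only when [h_partial R Q]
   converges. *)
Definition h_const (R : realType) (Q : {poly int}) : R :=
  limn (h_partial R Q).

Definition h1 (R : realType) : R := h_const R ((2%:P * 'X) ^+ 2 + 1).

Definition terms (Q : {poly int}) : set int :=
  range (fun x : nat => Q.[x%:Z]).

(* Main.v *)
Require Import Defs.
From HB Require Import structures.
From mathcomp Require Import all_boot all_order all_algebra.
From mathcomp Require Import all_classical all_reals all_analysis.
From mathcomp Require Import ring lra zify finfield.

Set Implicit Arguments.
Unset Strict Implicit.
Unset Printing Implicit Defensive.

Import Order.TTheory GRing.Theory Num.Theory.
Import numFieldNormedType.Exports.

Local Open Scope classical_set_scope.
Local Open Scope ring_scope.

(** The forms are [Q_k = (m 2^k (2X + 1))^2 + 1], where [m] is a product of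
    distinct primes congruent to 1 modulo 4.  Let [p] be an odd prime.  If [p]
    does not divide [m], then [X |-> m 2^k (2X + 1)] is a bijection of the field
    with [p] elements, so [Q_k] has as many roots as [X^2 + 1], that is, as many
    as [(2X)^2 + 1].  If [p] divides [m], then [Q_k] is the constant 1 modulo [p]
    and has no roots, which multiplies the factor [(p - 2) / (p - 1)] by
    [p / (p - 2)].  Hence [h_{Q_k} = h_1 * \prod_(p | m) p / (p - 2)] for every
    [k] (lemma [h_partial_sq_form]), and since a term of [Q_k] is [y^2 + 1] with
    [y] of 2-adic valuation exactly [k], the sets of terms are disjoint
    ([terms_sq_form_disjoint]).

    The numbers [p / (p - 2)] exceed 1, tend to 1, and have unbounded products
    because the sum of [1 / p] over the primes [p = 1 mod 4] diverges.  Therefore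
    multiplying them one after the other, starting from a large [p], until the
    product passes [h / h_1] gives an arbitrarily good approximation
    ([greedy_product]).

    Two analytic facts remain: this divergence, and the convergence of the
    product [h_1] to a positive limit ([h1_product_cvg]).  Both rest on estimates
    of Mertens.  For a completely multiplicative [f] with partial sums [F],
    expanding [ln n] over the prime powers dividing [n] turns the sum of
    [f(n) ln n] for [n <= N] into the sum over the primes [p <= N] of
    [ln p f(p) F(N / p)], up to a bounded contribution of the higher prime powers
    ([mult_ln_sum_primes]).
    - With [f = 1] this gives [\sum_(p <= N) ln p / p >= ln N - 3], so
      [\sum 1 / p] diverges ([sum_inv_prime_unbounded]).
    - With [f(n) = chi(n) / n], where [chi] is the nontrivial character modulo 4,
      [F(N / p)] may be replaced by [F(N)] at the cost of
      [N^-1 \sum_(p <= N) ln p], bounded by Chebyshev's estimate [theta_le].  As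
      [F(N)] stays away from 0 and the left-hand side is a bounded alternating
      sum, [\sum_(p <= N) chi(p) ln p / p] is bounded ([chi4_mertens]).  Summation
      by parts against [1 / ln p] shows that [\sum chi(p) / p] converges, with an
      explicit bound for its tails ([chi4_prime_tail]).

    The factor of [h_1] at [p] is [1 - chi(p) / (p - 1)], whose logarithm is
    [- chi(p) / p] up to a summable error; this gives the convergence of [h_1].
    Adding [\sum 1 / p] and [\sum chi(p) / p] gives the divergence along
    [p = 1 mod 4]. *)

(** * Summation by parts *)

Lemma summation_by_parts (R : comPzRingType) (a g : nat -> R) (m n : nat) :
  (m <= n)%N ->
  \sum_(m <= k < n) a k * g k =
    (\sum_(m <= k < n) a k) * g n +
    \sum_(m <= k < n) (\sum_(m <= j < k.+1) a j) * (g k - g k.+1).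
Proof.
elim: n => [|n IH]; first by rewrite leqn0 => /eqP->; rewrite !big_geq// mul0r addr0.
rewrite leq_eqVlt => /orP[/eqP<-|]; first by rewrite !big_geq// mul0r addr0.
by rewrite ltnS => mn; rewrite !(@big_nat_recr _ _ _ n m)//= IH//; ring.
Qed.

(** In the summation by parts the increments of the monotone weight [g] have
    constant sign, so their absolute values telescope to [g m]. *)
Lemma dirichlet_test_bound (R : realFieldType) (a g : nat -> R) (B : R)
    (m n : nat) :
  (forall j, (m <= j)%N -> `|\sum_(m <= k < j) a k| <= B) ->
  (forall k, (m <= k)%N -> 0 <= g k) ->
  (forall k, (m <= k)%N -> g k.+1 <= g k) ->
  `|\sum_(m <= k < n) a k * g k| <= B * g m.
Proof.
move=> aB g0 gdec.
have B0 : 0 <= B by apply: le_trans (aB m (leqnn m)); rewrite normr_ge0.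
have [nm|/ltnW mn] := leqP n m.
  by rewrite big_geq// normr0 mulr_ge0// g0.
rewrite summation_by_parts// (le_trans (ler_normD _ _))//.
have -> : B * g m = B * g n + \sum_(m <= k < n) B * (g k - g k.+1).
  rewrite -big_distrr/= -mulrDr; congr (B * _).
  under eq_bigr do rewrite -opprB.
  by rewrite sumrN telescope_sumr//; ring.
apply: lerD; first by rewrite normrM (ger0_norm (g0 _ mn)) ler_wpM2r// ?g0// aB.
apply: le_trans (ler_norm_sum _ _ _) _.
apply: ler_sum_nat => k /andP[mk _].
have d0 : 0 <= g k - g k.+1 by rewrite subr_ge0 gdec.
by rewrite normrM (ger0_norm d0) ler_wpM2r// aB// leqW.
Qed.

(** * The nontrivial character modulo 4 *)

(** The Dirichlet character with values 0, 1, 0, -1 at 0, 1, 2, 3 modulo 4. *)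
Definition chi4 (R : pzRingType) (n : nat) : R :=
  if odd n then (-1) ^+ n./2 else 0.

Lemma chi4M (R : pzRingType) (m n : nat) :
  chi4 R (m * n) = chi4 R m * chi4 R n.
Proof.
rewrite /chi4 oddM; case: (boolP (odd m)) => om /=; last by rewrite mul0r.
case: (boolP (odd n)) => on /=; last by rewrite mulr0.
rewrite -exprD.
have -> : ((m * n)./2 = (m./2 * n./2).*2 + (m./2 + n./2))%N.
  have := odd_double_half m; have := odd_double_half n; rewrite om on /=.
  by nia.
by rewrite exprD -mul2n exprM sqrrN !expr1n mul1r.
Qed.

Lemma chi4_norm (R : numDomainType) (n : nat) : `|chi4 R n| <= 1.
Proof. by rewrite /chi4; case: ifP; rewrite ?normr0// normrX normrN normr1 expr1n. Qed.

(** The values 1 and -1 alternate along the odd numbers, so the partial sums are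
    0, 0, 1, 1, 0, 0, 1, 1, and so on. *)
Lemma sum_chi4 (R : pzRingType) (n : nat) :
  \sum_(0 <= k < n) chi4 R k = (odd n./2)%:R.
Proof.
elim: n => [|n IH]; first by rewrite big_geq.
rewrite big_nat_recr//= IH /chi4 uphalf_half.
case: (odd n) => /=; last by rewrite addr0.
by rewrite -signr_odd; case: (odd n./2); rewrite /= ?expr1 ?expr0 ?subrr ?add0r.
Qed.

Lemma sum_chi4_norm (R : realDomainType) (m n : nat) :
  `|\sum_(m <= k < n) chi4 R k| <= 1.
Proof.
have [nm|/ltnW mn] := leqP n m; first by rewrite big_geq// normr0.
have := @big_cat_nat _ _ (@GRing.add R) m 0 n xpredT (chi4 R) isT mn.
rewrite !sum_chi4/= => /(congr1 (fun x => x - (odd m./2)%:R)).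
rewrite [X in _ = X -> _]addrC addrA addNr add0r => <-.
by case: (odd n./2); case: (odd m./2);
   rewrite ?subrr ?subr0 ?sub0r ?normrN ?normr1 ?normr0//.
Qed.

(** * Expansion of the logarithm over prime powers *)

Lemma sum_mul_dvdn (R : pzRingType) (f : nat -> R) (d N : nat) :
  (forall x y, f (x * y)%N = f x * f y) -> (0 < d)%N ->
  \sum_(1 <= n < N.+1 | (d %| n)%N) f n = f d * \sum_(1 <= m < (N %/ d).+1) f m.
Proof.
move=> fM d0; elim: N => [|N IH].
  by rewrite div0n !big_geq// mulr0.
rewrite big_mkcond big_nat_recr//= -big_mkcond/= IH divnS//.
case: (boolP (d %| N.+1)%N) => [/dvdnP[q qE]|_]; last by rewrite addr0 add0n.
rewrite add1n [X in _ = _ * X]big_nat_recr//= mulrDr -fM; congr (_ + f _).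
have -> : (N %/ d).+1 = q; last by rewrite mulnC.
by have := divnS N d0; rewrite qE dvdn_mull// mulnK// add1n.
Qed.

Lemma logn_sum (p n N : nat) : prime p -> (0 < n <= N)%N ->
  logn p n = (\sum_(1 <= k < N.+1) (p ^ k %| n))%N.
Proof.
move=> pp /andP[n0 nN]; rewrite logn_count_dvd//.
rewrite (@big_cat_nat _ _ _ n 1 N.+1)//=; last by rewrite leqW.
rewrite -[LHS]addn0; congr (_ + _)%N; apply/esym.
rewrite big_nat_cond big1// => k /andP[/andP[nk _] _].
by apply/eqP; rewrite eqb0; apply/negP => /(dvdn_leq n0);
   rewrite leqNgt (leq_ltn_trans nk)// ltn_expl// prime_gt1.
Qed.

(** The common bound [N] on the primes, independent of [n], is what allows the
    sums over [n] and [p] to be exchanged in [mult_ln_sum]. *)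
Lemma ln_prime_sum (R : realType) (n N : nat) : (0 < n <= N)%N ->
  ln (n%:R : R) = \sum_(1 <= p < N.+1 | prime p) ln p%:R *+ logn p n.
Proof.
move=> /andP[n0 nN].
rewrite -{1}(partnT n0) (widen_partn _ nN) natr_prod.
rewrite [X in ln X](eq_bigl xpredT)// big_mkcond/= big_nat_recl// [X in ln (X * _)]/=.
rewrite expn0 mul1r [RHS]big_mkcond/= big_add1/=.
pose K (x y : R) := 0 < x /\ ln x = y.
apply: (proj2 (_ : K _ _)).
rewrite [X in K X _]big_nat [X in K _ X]big_nat.
apply: (big_ind2 K) => [|x y x' y' [x0 xy] [x'0 xy']|p /andP[p0 _]].
- by split; [exact: ltr01|exact: ln1].
- by split; [exact: mulr_gt0|rewrite lnM ?posrE// xy xy'].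
- rewrite /K; case: ifP => pp; last by rewrite lognE pp expn0 ln1.
  by rewrite natrX lnXn ?exprn_gt0// ltr0n prime_gt0.
Qed.

Lemma geometric_tail (R : realFieldType) (p j : nat) : (1 < p)%N ->
  \sum_(2 <= k < j.+2) (p ^ k)%:R^-1 =
    (1 - (p ^ j)%:R^-1) / (p%:R * (p%:R - 1)) :> R.
Proof.
move=> p1; have p1R : 1 < p%:R :> R by rewrite ltr1n.
elim: j => [|j IH]; first by rewrite big_geq// expn0 invr1 subrr mul0r.
rewrite big_nat_recr//= IH !expnS !natrM.
have pj0 : (p ^ j)%:R != 0 :> R by rewrite pnatr_eq0 -lt0n expn_gt0 ltnW.
have p0 : p%:R != 0 :> R by apply/eqP; lra.
have p10 : p%:R - 1 != 0 :> R by apply/eqP; lra.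
by field; rewrite ?pj0 ?p0 ?p10.
Qed.

Lemma geometric_tail_le (R : realFieldType) (p n : nat) : (1 < p)%N ->
  \sum_(2 <= k < n) (p ^ k)%:R^-1 <= (p%:R * (p%:R - 1))^-1 :> R.
Proof.
move=> p1; have p1R : 1 < p%:R :> R by rewrite ltr1n.
have B0 : 0 <= (p%:R * (p%:R - 1))^-1 :> R.
  by rewrite invr_ge0 mulr_ge0 ?subr_ge0// ltW.
have [n2|/ltnW n2] := leqP n 2; first by rewrite big_geq.
by rewrite -(subnK n2) addn2 geometric_tail// ler_piMl// gerBl invr_ge0.
Qed.

Lemma ln_succ_le (R : realType) (n : nat) : (0 < n)%N ->
  ln (n.+1%:R : R) <= ln n%:R + n%:R^-1.
Proof.
move=> n0; have n0R : 0 < n%:R :> R by rewrite ltr0n.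
have -> : n.+1%:R = n%:R * (1 + n%:R^-1) :> R.
  by rewrite mulrDr mulr1 mulfV ?gt_eqF// -natr1.
have i0 : 0 < n%:R^-1 :> R by rewrite invr_gt0.
rewrite lnM ?posrE ?addr_gt0// lerD2l le_ln1Dx//.
by rewrite (lt_trans _ i0)// ltrN10.
Qed.

(** The terms are dominated by the differences [G (n - 1) - G n] for
    [G n = (2 + ln n) / n], and the sum of these telescopes to at most [G 1 = 2]. *)
Lemma sum_ln_over_sq (R : realType) (N : nat) :
  \sum_(2 <= n < N) ln n%:R / (n%:R * (n%:R - 1)) <= 2 :> R.
Proof.
(* Negated and with the index shifted by one, so that [telescope_sumr] applies
   and [G n.+1 - G n] bounds the term at [n]. *)
pose G (n : nat) : R := - ((2 + ln n.-1%:R) / n.-1%:R).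
have [N2|/ltnW N2] := leqP N 2; first by rewrite big_geq.
apply: (@le_trans _ _ (\sum_(2 <= n < N) (G n.+1 - G n))); last first.
  rewrite telescope_sumr// /G/= ln1 addr0 divr1 opprK gerDr oppr_le0.
  by rewrite divr_ge0// addr_ge0// ln_ge0// ler1n -ltnS prednK//; lia.
apply: ler_sum_nat => -[|[|n]]// _; rewrite /G /=.
have := @ln_succ_le R n.+1 isT.
set x : R := n.+1%:R; have -> : n.+2%:R = x + 1 :> R by rewrite -natr1.
have x1 : 1 <= x by rewrite /x ler1n.
clearbody x.
have xN0 : x != 0 by apply/eqP; lra.
have x1N0 : x + 1 != 0 by apply/eqP; lra.
have -> : x + 1 - 1 = x by ring.
move=> h; rewrite -subr_ge0.
have -> : - ((2 + ln (x + 1)) / (x + 1)) - - ((2 + ln x) / x)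
   - ln (x + 1) / ((x + 1) * x) =
   ((x + 1) * (ln x + x^-1 - ln (x + 1)) + (1 - x^-1)) / ((x + 1) * x).
  by field; rewrite ?x1N0 ?xN0.
have : x^-1 <= 1 by rewrite invf_le1//; lra.
have : 0 <= x by lra.
move=> x0 xi; rewrite divr_ge0//; last by nra.
by rewrite addr_ge0 ?mulr_ge0 ?subr_ge0//; lra.
Qed.

(** Exchange of summations after writing [ln n] as the sum of [ln p] over the
    prime powers [p ^ k] dividing [n]; complete multiplicativity of [f] makes the
    sum over the multiples of [p ^ k] a multiple of a shorter partial sum. *)
Lemma mult_ln_sum (R : realType) (f : nat -> R) (N : nat) :
  (forall x y, f (x * y)%N = f x * f y) ->
  \sum_(1 <= n < N.+1) f n * ln n%:R =
  \sum_(1 <= p < N.+1 | prime p) \sum_(1 <= k < N.+1)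
     ln p%:R * (f (p ^ k)%N * \sum_(1 <= m < (N %/ p ^ k).+1) f m).
Proof.
move=> fM.
transitivity (\sum_(1 <= n < N.+1) \sum_(1 <= p < N.+1 | prime p)
  \sum_(1 <= k < N.+1) ln p%:R * (if (p ^ k %| n)%N then f n else 0)).
  apply: eq_big_nat => n /andP[n0 nN]; rewrite (@ln_prime_sum _ n N) ?n0// big_distrr/=.
  apply: eq_bigr => p pp; rewrite (@logn_sum p n N) ?n0// -sumrMnr big_distrr/=.
  apply: eq_bigr => k _.
  by case: (p ^ k %| n)%N; rewrite ?mulr1n ?mulr0n ?mulr0 1?mulrC.
rewrite exchange_big/=; apply: eq_bigr => p pp.
rewrite exchange_big/=; apply: eq_bigr => k _.
by rewrite -big_distrr -big_mkcond sum_mul_dvdn// expn_gt0 prime_gt0.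
Qed.

(** In [mult_ln_sum] the prime powers with [k >= 2] contribute at most
    [K \sum_p ln p / (p (p - 1))], so only the primes themselves matter. *)
Lemma mult_ln_sum_primes (R : realType) (f : nat -> R) (N : nat) (K : R) :
  (forall x y, f (x * y)%N = f x * f y) ->
  (forall d, (0 < d)%N ->
     `|f d * \sum_(1 <= m < (N %/ d).+1) f m| <= K / d%:R) ->
  `|\sum_(1 <= n < N.+1) f n * ln n%:R -
    \sum_(1 <= p < N.+1 | prime p)
       ln p%:R * (f p * \sum_(1 <= m < (N %/ p).+1) f m)| <= 2 * K.
Proof.
move=> fM fK.
have K0 : 0 <= K by have := fK 1%N isT; rewrite divr1; apply: le_trans.
case: N fK => [|N] fK; first by rewrite !big_geq// subrr normr0 mulr_ge0.
rewrite mult_ln_sum// -sumrB.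
apply: (@le_trans _ _ (\sum_(2 <= p < N.+2) K * (ln p%:R / (p%:R * (p%:R - 1))))); last first.
  by rewrite -big_distrr/= mulrC ler_wpM2r// sum_ln_over_sq.
rewrite big_ltn_cond//= (le_trans (ler_norm_sum _ _ _))//.
rewrite big_mkcond; apply: ler_sum_nat => p /andP[p1 _].
have p1R : 1 < p%:R :> R by rewrite ltr1n.
have lnp : 0 <= ln (p%:R : R) by rewrite ln_ge0// ltW.
case: ifP => pp; last by rewrite mulr_ge0// divr_ge0// mulr_ge0// subr_ge0 ltW.
rewrite big_ltn// !expn1 addrAC subrr add0r.
apply: le_trans (ler_norm_sum _ _ _) _.
apply: (@le_trans _ _ (\sum_(2 <= k < N.+2) (K * ln p%:R) * (p ^ k)%:R^-1)).
  apply: ler_sum_nat => k _; rewrite normrM (ger0_norm lnp) [K * _]mulrC -mulrA.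
  by rewrite ler_wpM2l// fK// expn_gt0 prime_gt0.
by rewrite -big_distrr/= mulrA ler_wpM2l ?mulr_ge0// geometric_tail_le.
Qed.

(** * Chebyshev's upper bound *)

Lemma prod_primes_dvd (a b X : nat) :
  (forall p, prime p -> (a <= p < b)%N -> (p %| X)%N) ->
  (\prod_(a <= p < b | prime p) p %| X)%N.
Proof.
elim: b => [|b IH] dX; first by rewrite big_geq ?dvd1n.
have [ba|ab] := ltnP b a; first by rewrite big_geq ?dvd1n.
rewrite big_mkcond big_nat_recr//= -big_mkcond/=.
have IH' : (\prod_(a <= p < b | prime p) p %| X)%N.
  by apply: IH => p pp /andP[ap pb]; apply: dX; rewrite // ap ltnW.
case: ifP => pb; last by rewrite muln1.
rewrite Gauss_dvd ?IH'/= ?dX ?ab ?ltnSn//.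
rewrite big_nat_cond; elim/big_ind: _ => [|x y cx cy|p /andP[/andP[ap lpb] pp]].
- exact: coprime1n.
- by rewrite coprimeMl cx cy.
- by rewrite prime_coprime// dvdn_prime2// neq_ltn lpb.
Qed.

Lemma prime_dvdn_fact_leq (p n : nat) : prime p -> (p %| n`!)%N -> (p <= n)%N.
Proof.
move=> pp; elim: n => [|n IH]; first by rewrite fact0 dvdn1 => /eqP p1; rewrite p1 in pp.
rewrite factS Euclid_dvdM// => /orP[/dvdn_leq->//|/IH/leqW//].
Qed.

(** The two equal central coefficients of [(1 + 1) ^ (2m + 1)] sum to at most
    [2 ^ (2m + 1)]. *)
Lemma bin_middle_le (m : nat) : ('C(m.*2.+1, m) <= 4 ^ m)%N.
Proof.
rewrite -(@leq_pmul2l 2)//.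
have -> : (2 * 4 ^ m = 2 ^ m.*2.+1)%N by rewrite expnS -mul2n expnM.
have -> : (2 * 'C(m.*2.+1, m) = 'C(m.*2.+1, m) + 'C(m.*2.+1, m.+1))%N.
  rewrite mul2n -addnn; congr (_ + _)%N.
  rewrite -bin_sub; last by lia.
  by congr ('C(_, _)); lia.
rewrite -[2%N]/(1 + 1)%N expnDn.
have mlt : (m < m.*2.+2)%N by lia.
have m1lt : (m.+1 < m.*2.+2)%N by lia.
rewrite (bigD1 (Ordinal mlt))//= (bigD1 (Ordinal m1lt))//=; last first.
  by rewrite -val_eqE /= gtn_eqF.
by rewrite !exp1n !muln1 addnA leq_addr.
Qed.

(** For [n = 2m + 1] the primes in [m + 2, 2m + 1] all divide ['C(2m + 1, m)], which is
    at most [4 ^ m]; those up to [m + 1] are handled by induction. *)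
Lemma primorial_le (n : nat) : (\prod_(1 <= p < n.+1 | prime p) p <= 4 ^ n)%N.
Proof.
elim/ltn_ind: n => n IH.
have [n2|n2] := leqP n 2.
  case: n n2 {IH} => [|[|[|//]]] _; rewrite big_mkcond/= /index_iota/=.
  - by rewrite big_nil.
  - by rewrite !big_cons big_nil.
  - by rewrite !big_cons big_nil.
case: (boolP (odd n)) => on; last first.
  have npr : ~~ prime n by apply: contra on => /even_prime[n2'|//]; rewrite n2' in n2.
  rewrite big_mkcond big_nat_recr/= ?(negPf npr) ?muln1 -?big_mkcond/=; last by lia.
  have -> : n = n.-1.+1 by lia.
  apply: leq_trans (IH n.-1 _) _; first by lia.
  by rewrite leq_exp2l.
set m := n./2; have nE : n = m.*2.+1 by have := odd_double_half n; rewrite on; lia.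
rewrite (@big_cat_nat _ _ _ m.+2)//=; [|lia..].
have -> : (4 ^ n = 4 ^ m.+1 * 4 ^ m)%N by rewrite -expnD; congr (_ ^ _)%N; lia.
apply: leq_mul; first by apply: IH; lia.
apply: leq_trans (bin_middle_le m).
rewrite dvdn_leq ?bin_gt0//; first by lia.
apply: prod_primes_dvd => p pp /andP[mp pn].
have mm : (m <= m.*2.+1)%N by lia.
have := bin_fact mm; have -> : (m.*2.+1 - m = m.+1)%N by lia.
move=> binE; have : (p %| (m.*2.+1)`!)%N by rewrite dvdn_fact// prime_gt0//=; lia.
rewrite -binE 2?Euclid_dvdM// => /or3P[//|pf|pf];
  have := prime_dvdn_fact_leq pp pf; lia.
Qed.

Lemma theta_le (R : realType) (N : nat) :
  \sum_(1 <= p < N.+1 | prime p) ln p%:R <= N%:R * ln 4 :> R.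
Proof.
have -> : \sum_(1 <= p < N.+1 | prime p) ln p%:R =
   ln (\prod_(1 <= p < N.+1 | prime p) p)%N%:R :> R.
  pose K (x : R) (y : nat) := (0 < y)%N /\ x = ln y%:R.
  apply: (proj2 (_ : K _ _)).
  apply: (big_ind2 K) => [|x y x' y' [x0 xy] [x'0 xy']|p pp].
  - by split; rewrite ?ln1.
  - by split; [rewrite muln_gt0 x0|rewrite natrM lnM ?posrE ?ltr0n// xy xy'].
  - by split; rewrite ?prime_gt0.
rewrite mulr_natl -lnXn// -natrX ler_ln ?posrE ?ltr0n ?expn_gt0//.
  by rewrite ler_nat primorial_le.
by rewrite big_mkcond; elim/big_ind: _ => // [x y x0 y0|p _];
  rewrite ?muln_gt0 ?x0//; case: ifP => // /prime_gt0.
Qed.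

(** * Divergence of the sum of inverses of primes *)

Lemma sum_ln_ge (R : realType) (N : nat) :
  N%:R * ln N%:R - N%:R <= \sum_(1 <= n < N.+1) ln n%:R :> R.
Proof.
elim: N => [|[|N] IH]; first by rewrite big_geq// mul0r subr0.
  by rewrite big_nat1 ln1; lra.
rewrite big_nat_recr//=; apply: le_trans (lerD IH (lexx _)).
have := @ln_succ_le R N.+1 isT.
have x1 : 0 < N.+1%:R :> R by rewrite ltr0n.
rewrite -[in X in _ -> X](natr1 N.+1) -[in X in X -> _](natr1 N.+1); move: (N.+1%:R : R) x1 => x x0 h.
have : x * ln (x + 1) <= x * ln x + 1.
  have -> : x * ln x + 1 = x * (ln x + x^-1) by rewrite mulrDr mulfV ?gt_eqF.
  by rewrite ler_pM2l.
by lra.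
Qed.

Lemma natr_div_le (R : realFieldType) (N d : nat) :
  (N %/ d)%:R <= N%:R / d%:R :> R.
Proof.
case: d => [|d]; first by rewrite divn0 invr0 mulr0.
by rewrite ler_pdivlMr ?ltr0n// -natrM ler_nat leq_divM.
Qed.

(** The estimate [mult_ln_sum_primes] for [f = 1], whose left-hand side is
    [ln (N!)], combined with the lower bound of Stirling type [sum_ln_ge]. *)
Lemma sum_ln_div_prime_ge (R : realType) (N : nat) : (0 < N)%N ->
  ln N%:R - 3 <= \sum_(1 <= p < N.+1 | prime p) ln p%:R / p%:R :> R.
Proof.
move=> N0; have N0R : 0 < N%:R :> R by rewrite ltr0n.
have sum1 M : \sum_(1 <= m < M.+1) (1 : R) = M%:R.
  by rewrite sumr_const_nat subn1.
have := @mult_ln_sum_primes R (fun=> 1) N N%:R (fun _ _ => esym (mulr1 1)).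
have fK d : (0 < d)%N -> `|1 * \sum_(1 <= m < (N %/ d).+1) (1 : R)| <= N%:R / d%:R.
  by move=> _; rewrite mul1r sum1 ger0_norm// natr_div_le.
move=> /(_ fK) /ler_normlW; rewrite lerBlDr => up.
have := sum_ln_ge R N; under eq_bigr do rewrite -[ln _]mul1r.
move=> /le_trans/(_ up){up} low.
have : \sum_(1 <= p < N.+1 | prime p)
         ln p%:R * (1 * \sum_(1 <= m < (N %/ p).+1) 1)
    <= N%:R * \sum_(1 <= p < N.+1 | prime p) ln p%:R / p%:R :> R.
  rewrite big_distrr/=; apply: ler_sum => p pp; rewrite mul1r sum1 mulrCA.
  by rewrite ler_wpM2l ?natr_div_le// ln_ge0// ler1n prime_gt0.
move: (\sum_(_ <= _ < _ | _) _) low => x low; set y := bigop _ _ _ => xy.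
by rewrite -(ler_pM2l N0R); lra.
Qed.

(** If every such sum were below [1 / 2], then [\sum_(p <= N) ln p / p] would be at
    most [ln N / 2] up to a constant, against [sum_ln_div_prime_ge]. *)
Lemma sum_inv_prime_half (R : realType) (K : nat) : (0 < K)%N ->
  exists2 n, (K <= n)%N & 2^-1 <= \sum_(K <= p < n | prime p) p%:R^-1 :> R.
Proof.
move=> K0.
have [[n /andP[Kn hn]]|no] := pselect (exists n, (K <= n)%N &&
    (2^-1 <= \sum_(K <= p < n | prime p) p%:R^-1 :> R)).
  by exists n.
have small n : (K <= n)%N -> \sum_(K <= p < n | prime p) p%:R^-1 < 2^-1 :> R.
  by move=> Kn; rewrite ltNge; apply/negP => h; apply: no; exists n; rewrite Kn.
pose A : R := \sum_(1 <= p < K | prime p) ln p%:R / p%:R.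
(* [N] is so large that [ln N - 3] exceeds [A + ln N / 2]. *)
pose N := maxn K (Num.truncn (expR (2 * (A + 3)))).+1.
have KN : (K <= N)%N by rewrite leq_max leqnn.
have N0 : (0 < N)%N by apply: leq_trans KN.
have lnN : 2 * (A + 3) < ln N%:R.
  rewrite -[X in X < _]expRK ltr_ln ?posrE ?expR_gt0 ?ltr0n//.
  by apply: lt_le_trans (truncnS_gt _) _; rewrite ler_nat leq_max leqnn orbT.
have := @sum_ln_div_prime_ge R N N0.
rewrite (@big_cat_nat _ _ _ K)//=; last by rewrite leqW.
rewrite -/A.
have : \sum_(K <= p < N.+1 | prime p) ln p%:R / p%:R <= ln N%:R / 2 :> R.
  apply: (@le_trans _ _ (ln N%:R * \sum_(K <= p < N.+1 | prime p) p%:R^-1)).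
    rewrite big_distrr/= !(big_mkcond prime); apply: ler_sum_nat => p /andP[Kp pN].
    case: ifP => // pp; rewrite ler_wpM2r ?invr_ge0//.
    by rewrite ler_ln ?posrE ?ltr0n ?(prime_gt0 pp)// ler_nat.
  apply: ler_wpM2l; first by rewrite ln_ge0// ler1n.
  by rewrite ltW// small// leqW.
by lra.
Qed.

Lemma sum_inv_prime_unbounded (R : realType) (K : nat) (A : R) : (0 < K)%N ->
  exists2 n, (K <= n)%N & A <= \sum_(K <= p < n | prime p) p%:R^-1.
Proof.
move=> K0.
have [n [Kn hn]] : exists n, (K <= n)%N /\
    (Num.truncn (2 * A)).+1%:R / 2 <= \sum_(K <= p < n | prime p) p%:R^-1 :> R.
  elim: (Num.truncn _).+1 => [|j [n [Kn IH]]].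
    by exists K; split; rewrite // mul0r big_geq.
  have [n' nn' h] := @sum_inv_prime_half R n (leq_trans K0 Kn).
  exists n'; split; first exact: leq_trans nn'.
  by rewrite (@big_cat_nat _ _ _ n)//= -natr1 mulrDl mul1r lerD.
exists n => //; apply: le_trans hn.
by rewrite ler_pdivlMr// mulrC ltW// truncnS_gt.
Qed.

(** * The character sum over primes *)

Lemma invr_nat_decr (R : realFieldType) (k : nat) : (0 < k)%N ->
  (k.+1)%:R^-1 <= k%:R^-1 :> R.
Proof. by move=> k0; rewrite lef_pV2 ?posrE ?ltr0n// ler_nat. Qed.

Lemma chi4_tail (R : realFieldType) (m n : nat) : (0 < m)%N ->
  `|\sum_(m <= k < n) chi4 R k / k%:R| <= m%:R^-1.
Proof.
move=> m0; rewrite -[X in _ <= X]mul1r.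
apply: (@dirichlet_test_bound _ (chi4 R) (fun k => k%:R^-1)) => [j _|k mk|k mk].
- exact: sum_chi4_norm.
- by rewrite invr_ge0.
- by apply: invr_nat_decr; exact: leq_trans mk.
Qed.

(** The bound is [1 - 1/3 - 1/5]: the partial sum up to 4, minus the bound of
    [chi4_tail] for the remaining terms. *)
Lemma chi4_L_ge (R : realFieldType) (N : nat) : (4 <= N)%N ->
  7 / 15 <= \sum_(1 <= m < N.+1) chi4 R m / m%:R.
Proof.
move=> N4; rewrite (@big_cat_nat _ _ _ 5)//=.
have := @chi4_tail R 5 N.+1 isT.
rewrite ler_norml => /andP[+ _].
have -> : \sum_(1 <= m < 5) chi4 R m / m%:R = 2 / 3.
  rewrite /index_iota/= !big_cons big_nil /chi4/= !expr0 expr1.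
  by field.
by lra.
Qed.

Lemma ln4_ge1 (R : realType) : 1 <= ln 4 :> R.
Proof.
have h2 : 2^-1 <= ln 2 :> R.
  have : ln (2^-1) <= - 2^-1 :> R.
    have -> : 2^-1 = 1 + - 2^-1 :> R by field.
    by apply: le_trans (le_ln1Dx _) _; lra.
  by rewrite lnV ?posrE// lerNl opprK.
have -> : 4 = 2 * 2 :> R by rewrite -natrM.
by rewrite lnM ?posrE//; lra.
Qed.

(** The function [ln x / x] decreases only from [x = exp 1] on; starting at 4
    makes [1 <= ln x] easy to obtain from [ln 2 >= 1 / 2]. *)
Lemma ln_div_decr (R : realType) (k : nat) : (4 <= k)%N ->
  ln k.+1%:R / k.+1%:R <= ln k%:R / k%:R :> R.
Proof.
move=> k4; have k0 : (0 < k)%N by apply: leq_trans k4.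
have := @ln_succ_le R k k0.
have : 1 <= ln k%:R :> R.
  apply: le_trans (ln4_ge1 R) _.
  by rewrite ler_ln ?posrE ?ltr0n// ler_nat.
have : 0 < k%:R :> R by rewrite ltr0n.
rewrite -[k.+1%:R]natr1; move: (k%:R : R) => x x0 lx h.
rewrite ler_pdivrMr ?addr_gt0// mulrAC ler_pdivlMr//.
have : ln (x + 1) * x <= (ln x + x^-1) * x by rewrite ler_pM2r.
by rewrite !mulrDl mulVf ?gt_eqF//; lra.
Qed.

Lemma chi4_ln_bounded (R : realType) : exists C : R, forall N, (4 <= N)%N ->
  `|\sum_(1 <= n < N.+1) chi4 R n / n%:R * ln n%:R| <= C.
Proof.
exists (`|\sum_(1 <= n < 4) chi4 R n / n%:R * ln n%:R| + 1 * (ln 4 / 4)) => N N4.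
rewrite (@big_cat_nat _ _ _ 4)//=; last by rewrite ltnW.
apply: le_trans (ler_normD _ _) _; rewrite lerD2l.
under eq_bigr do rewrite mulrAC -mulrA.
apply: (@dirichlet_test_bound _ (chi4 R) (fun k => ln k%:R / k%:R)) => [j _|k mk|k mk].
- exact: sum_chi4_norm.
- by rewrite divr_ge0// ln_ge0// ler1n; apply: leq_trans mk.
- exact: ln_div_decr.
Qed.

(** This is where [L(1, chi) <> 0] is used, in the form [chi4_L_ge]: the
    character sum is a bounded quantity divided by a partial sum of [L(1, chi)]. *)
Lemma chi4_mertens (R : realType) : exists C : R, forall N, (4 <= N)%N ->
  `|\sum_(1 <= p < N.+1 | prime p) chi4 R p * ln p%:R / p%:R| <= C.
Proof.
have [C hC] := chi4_ln_bounded R.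
exists (15 / 7 * (C + 2 + ln 4)) => N N4.
pose f n : R := chi4 R n / n%:R.
pose T n : R := \sum_(1 <= m < n.+1) f m.
have N0R : 0 < N%:R :> R by rewrite ltr0n; apply: leq_trans N4.
have fM x y : f (x * y)%N = f x * f y.
  by rewrite /f chi4M natrM invfM mulrACA.
have f1 d : (0 < d)%N -> `|f d| <= d%:R^-1.
  move=> d0; rewrite /f normrM normfV normr_nat ler_piMl ?invr_ge0//.
  exact: chi4_norm.
have T1 n : `|T n| <= 1.
  by apply: le_trans (chi4_tail _ _ _) _; rewrite ?invr1.
have fK d : (0 < d)%N -> `|f d * \sum_(1 <= m < (N %/ d).+1) f m| <= 1 / d%:R.
  by move=> d0; rewrite normrM mulrC ler_pM// ?T1 ?f1.
have hS := hC _ N4.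
have := mult_ln_sum_primes fM fK.
set S := bigop _ _ _ in hS *; rewrite -/S.
set S1 := bigop _ _ _ => hS1.
set A := bigop _ _ _.
(* Replacing [T (N %/ p)] by [T N] costs at most [1 / (N %/ p + 1) < p / N]. *)
have hT : `|S1 - T N * A| <= ln 4.
  rewrite /S1 /A big_distrr/= -sumrB.
  apply: (@le_trans _ _ (N%:R^-1 * \sum_(1 <= p < N.+1 | prime p) ln p%:R)); last first.
    by rewrite ler_pdivrMl// theta_le.
  rewrite big_distrr/=; apply: le_trans (ler_norm_sum _ _ _) _.
  rewrite !(big_mkcond prime); apply: ler_sum_nat => p /andP[p0 pN].
  case: ifP => // pp; have p0R : 0 < p%:R :> R by rewrite ltr0n.
  have -> : ln p%:R * (f p * \sum_(1 <= m < (N %/ p).+1) f m)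
      - T N * (chi4 R p * ln p%:R / p%:R)
    = - (ln p%:R * (f p * (T N - T (N %/ p)%N))) by rewrite /T /f; ring.
  have lnp : 0 <= ln (p%:R : R) by rewrite ln_ge0// ler1n.
  rewrite normrN normrM (ger0_norm lnp) [X in _ <= X]mulrC ler_wpM2l//.
  have -> : T N - T (N %/ p)%N = \sum_((N %/ p).+1 <= k < N.+1) f k.
    rewrite /T (@big_cat_nat _ _ _ (N %/ p).+1 1 N.+1)//=; last first.
      by rewrite ltnS leq_div.
    by rewrite addrAC subrr add0r.
  rewrite normrM; apply: le_trans (ler_pM _ _ (f1 _ p0) (chi4_tail _ _ _)) _ => //.
  rewrite -invfM lef_pV2 ?posrE ?mulr_gt0// -natrM ler_nat mulnC.
  by rewrite ltnW// ltn_ceil.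
have hTA : `|T N * A| <= C + 2 + ln 4.
  have -> : T N * A = S - (S - S1) - (S1 - T N * A) by ring.
  apply: le_trans (ler_normB _ _) _; apply: lerD => //.
  apply: le_trans (ler_normB _ _) _; apply: lerD => //.
  by rewrite -[2]mulr1.
have TN := @chi4_L_ge R N N4; rewrite -/(T N) in TN.
move: hTA; rewrite normrM ger0_norm; last by lra.
have := normr_ge0 A; nra.
Qed.

(** Dirichlet's test with the bounded sums of [chi(p) ln p / p] and the decreasing
    weight [1 / ln p].  The tails tend to 0, so [\sum chi(p) / p] converges. *)
Lemma chi4_prime_tail (R : realType) : exists C : R, forall m n, (5 <= m)%N ->
  `|\sum_(m <= p < n | prime p) chi4 R p / p%:R| <= C / ln m%:R.
Proof.
have [C hC] := chi4_mertens R.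
exists (C + C) => m n m5.
pose a p : R := if prime p then chi4 R p * ln p%:R / p%:R else 0.
have -> : \sum_(m <= p < n | prime p) chi4 R p / p%:R =
          \sum_(m <= p < n) a p * (ln p%:R)^-1.
  rewrite big_mkcond; apply: eq_big_nat => p /andP[mp _]; rewrite /a.
  case: ifP => pp; last by rewrite mul0r.
  by rewrite mulrAC mulfK// gt_eqF// ln_gt0// ltr1n prime_gt1.
apply: (@dirichlet_test_bound _ a (fun k => (ln k%:R)^-1)) => [j mj|k mk|k mk].
- have hj := hC j.-1; have hm := hC m.-1; rewrite !prednK in hj hm; try by lia.
  have j0 : (1 <= m)%N by lia.
  have -> : \sum_(m <= k < j) a k = \sum_(1 <= k < j) a k - \sum_(1 <= k < m) a k.
    by rewrite (@big_cat_nat _ _ _ m 1 j)//= addrAC subrr add0r.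
  apply: le_trans (ler_normB _ _) _; rewrite /a -!big_mkcond/=.
  by apply: lerD; [apply: hj|apply: hm]; lia.
- by rewrite invr_ge0 ln_ge0// ler1n; lia.
- rewrite lef_pV2 ?posrE ?ln_gt0 ?ltr1n ?ler_ln ?posrE ?ltr0n ?ler_nat//; lia.
Qed.

Lemma chi4_odd (R : pzRingType) (n : nat) : odd n ->
  chi4 R n = if (n %% 4 == 1)%N then 1 else -1.
Proof.
move=> on; rewrite /chi4 on -signr_odd.
have -> : odd n./2 = ~~ (n %% 4 == 1)%N by lia.
by case: (n %% 4 == 1)%N; rewrite /= ?expr0 ?expr1.
Qed.

(** For odd [p], [1 + chi(p)] is 2 or 0 according as [p] is 1 or 3 modulo 4. *)
Lemma sum_inv_prime_1mod4_unbounded (R : realType) (K : nat) (A : R) : (5 <= K)%N ->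
  exists2 n, (K <= n)%N &
    A <= \sum_(K <= p < n | prime p && (p %% 4 == 1)%N) p%:R^-1.
Proof.
move=> K5; have [C hC] := chi4_prime_tail R.
have K0 : (0 < K)%N by lia.
have [n Kn hn] := sum_inv_prime_unbounded (2 * A + C / ln K%:R) K0.
exists n => //; have := hC K n K5; rewrite ler_norml => /andP[+ _].
have : 2 * \sum_(K <= p < n | prime p && (p %% 4 == 1)%N) p%:R^-1 =
   \sum_(K <= p < n | prime p) p%:R^-1 +
   \sum_(K <= p < n | prime p) chi4 R p / p%:R.
  rewrite -big_split/= big_distrr/= big_mkcondr/=.
  rewrite !(big_mkcond prime); apply: eq_big_nat => p /andP[Kp _].
  case: ifP => // pp.
  have op : odd p by case/even_prime: pp => // p2; lia.
  rewrite chi4_odd//; case: ifP => _; first by rewrite mul1r mulrDl mul1r.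
  by rewrite mulN1r subrr.
by move=> h1 h2; rewrite -(ler_pM2l (ltr0n R 2))// h1; lra.
Qed.

(** * Convergence of the product for X^2 + 1 *)

Lemma ln1D_quadratic (R : realType) (u : R) : `|u| <= 2^-1 ->
  `|ln (1 + u) - u| <= 2 * u ^+ 2.
Proof.
rewrite ler_norml => /andP[ul uu].
have u0 : 0 < 1 + u by lra.
have up : ln (1 + u) <= u by apply: le_ln1Dx; lra.
have low : u - 2 * u ^+ 2 <= ln (1 + u).
  have : ln ((1 + u)^-1) <= - (u / (1 + u)).
    have {1}-> : (1 + u)^-1 = 1 + - (u / (1 + u)).
      by field; rewrite gt_eqF.
    apply: le_ln1Dx; rewrite ltrN2 ltr_pdivrMr//; lra.
  rewrite lnV ?posrE// lerN2; apply: le_trans.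
  by rewrite ler_pdivlMr//; nra.
by rewrite ler_norml; have := sqr_ge0 u; move: up low; lra.
Qed.

(** The factor [(p - t_p) / (p - 1)] of [h_1], with [t_p = 1 + chi(p)]. *)
Definition h1_factor (R : realType) (p : nat) : R :=
  1 - chi4 R p / (p%:R - 1).

Lemma h1_factor_gt0 (R : realType) (p : nat) : (3 <= p)%N -> 0 < h1_factor R p.
Proof.
move=> p3; have p3R : 3 <= p%:R :> R by rewrite ler_nat.
rewrite /h1_factor subr_gt0 ltr_pdivrMr; last by lra.
have := chi4_norm R p; rewrite ler_norml => /andP[_]; lra.
Qed.

(** Two errors of order [p ^ -2] are combined: the second-order term of the
    logarithm and the difference between [1 / (p - 1)] and [1 / p]. *)
Lemma ln_h1_factor (R : realType) (p : nat) : (3 <= p)%N ->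
  `|ln (h1_factor R p) + chi4 R p / p%:R| <= 5 / (p%:R * (p%:R - 1)).
Proof.
move=> p3; have p3R : 3 <= p%:R :> R by rewrite ler_nat.
rewrite /h1_factor; have := chi4_norm R p.
move: (chi4 R p) (p%:R : R) p3R => c x x3 c1.
have x1 : 0 < x - 1 by lra.
have x0 : 0 < x by lra.
have u1 : `|- (c / (x - 1))| <= (x - 1)^-1.
  have i1 : 0 <= (x - 1)^-1 by rewrite invr_ge0 ltW.
  by rewrite normrN normrM (ger0_norm i1) ler_piMl.
have u2 : `|- (c / (x - 1))| <= 2^-1.
  by apply: le_trans u1 _; rewrite lef_pV2 ?posrE//; lra.
have := ln1D_quadratic u2; set l := ln _ => hl.
have -> : l + c / x = (l - - (c / (x - 1))) - c / (x * (x - 1)).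
  by field; rewrite !gt_eqF.
apply: le_trans (ler_normB _ _) _.
have -> : 5 / (x * (x - 1)) = 4 / (x * (x - 1)) + (x * (x - 1))^-1.
  by field; rewrite !gt_eqF.
apply: lerD; last first.
  have i2 : 0 <= (x * (x - 1))^-1 by rewrite invr_ge0 mulr_ge0// ltW.
  by rewrite normrM (ger0_norm i2) ler_piMl.
apply: le_trans hl _; rewrite -[_ ^+ 2]ger0_norm ?sqr_ge0// normrX.
apply: (@le_trans _ _ (2 * (x - 1)^-1 ^+ 2)).
  by rewrite ler_wpM2l// lerXn2r// nnegrE invr_ge0 ltW.
rewrite -subr_ge0.
have -> : 4 / (x * (x - 1)) - 2 * (x - 1)^-1 ^+ 2 = 2 * (x - 2) / (x * (x - 1) ^+ 2).
  by field; rewrite !gt_eqF.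
by rewrite divr_ge0 ?mulr_ge0 ?exprn_ge0//; lra.
Qed.

Lemma sum_inv_pronic_le (R : realFieldType) (m n : nat) : (2 <= m)%N ->
  \sum_(m <= k < n) (k%:R * (k%:R - 1))^-1 <= (m%:R - 1)^-1 :> R.
Proof.
move=> m2; have m0 : 0 <= (m%:R - 1)^-1 :> R.
  by rewrite invr_ge0 subr_ge0 ler1n ltnW.
have [nm|/ltnW mn] := leqP n m; first by rewrite big_geq.
have -> : \sum_(m <= k < n) (k%:R * (k%:R - 1))^-1 =
   \sum_(m <= k < n) (- (k.+1%:R - 1)^-1 - - (k%:R - 1)^-1) :> R.
  apply: eq_big_nat => k /andP[mk _].
  have k2 : 2 <= k%:R :> R by rewrite ler_nat (leq_trans m2).
  have k0 : k%:R != 0 :> R by apply/eqP; lra.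
  have k10 : k%:R - 1 != 0 :> R by apply/eqP; lra.
  by rewrite -[k.+1%:R]natr1 addrK; field; rewrite ?k0 ?k10.
rewrite telescope_sumr// opprK gerDr oppr_le0 invr_ge0 subr_ge0 ler1n.
by lia.
Qed.

(** The logarithms of the partial products form a Cauchy sequence, by
    [chi4_prime_tail] and [ln_h1_factor]; the limit is an exponential, hence
    positive. *)
Lemma h1_product_cvg (R : realType) : exists2 L : R, 0 < L &
  (fun N => \prod_(0 <= p < N.+1 | prime p && odd p) h1_factor R p) @ \oo --> L.
Proof.
have [C hC] := chi4_prime_tail R.
pose v k : R := if prime k && odd k then ln (h1_factor R k) else 0.
have tail m n : (5 <= m)%N ->
    `|\sum_(m <= k < n) v k| <= `|C| / ln m%:R + 5 / (m%:R - 1).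
  move=> m5; have lnm : 0 <= ln (m%:R : R) by rewrite ln_ge0// ler1n; lia.
  have -> : \sum_(m <= k < n) v k =
      \sum_(m <= k < n | prime k) (ln (h1_factor R k) + chi4 R k / k%:R)
      - \sum_(m <= k < n | prime k) chi4 R k / k%:R.
    rewrite -sumrB [RHS]big_mkcond; apply: eq_big_nat => k /andP[mk _].
    rewrite /v; case: (boolP (prime k)) => //= pk.
    have -> : odd k by case/even_prime: pk => // k2; lia.
    by rewrite addrK.
  apply: le_trans (ler_normB _ _) _; rewrite addrC; apply: lerD.
    apply: le_trans (hC m n m5) _.
    by rewrite ler_wpM2r ?invr_ge0// ler_norm.
  have m2 : (2 <= m)%N by lia.
  apply: (@le_trans _ _ (5 * \sum_(m <= k < n) (k%:R * (k%:R - 1))^-1)); last first.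
    by rewrite ler_wpM2l// sum_inv_pronic_le.
  apply: le_trans (ler_norm_sum _ _ _) _.
  rewrite big_distrr/= big_mkcond; apply: ler_sum_nat => k /andP[mk _].
  have k3 : (3 <= k)%N by lia.
  have k3R : 3 <= k%:R :> R by rewrite ler_nat.
  case: ifP => _; first exact: ln_h1_factor.
  by rewrite divr_ge0// mulr_ge0//; lra.
have cv : cvgn (series v).
  apply: cauchy_cvg; apply/cauchy_seriesP => e e0.
  pose M := maxn 5 (maxn (Num.truncn (expR (2 * `|C| / e))).+1
                         (Num.truncn (10 / e)).+2).
  exists ([set k | (M <= k)%N], [set k | (M <= k)%N]).
    by split; exact: nbhs_infty_ge.
  move=> -[m n]/= [+ _]; rewrite !geq_max => /and3P[m5 mC mE].
  apply: le_lt_trans (tail _ _ m5) _.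
  rewrite [X in _ < X](splitr e); apply: ltr_leD.
    have lnm : 0 < ln (m%:R : R) by rewrite ln_gt0// ltr1n; lia.
    have : 2 * `|C| / e < ln m%:R.
      rewrite -[X in X < _]expRK ltr_ln ?posrE ?expR_gt0 ?ltr0n//; last by lia.
      by apply: lt_le_trans (truncnS_gt _) _; rewrite ler_nat.
    by rewrite ltr_pdivrMr// => h; rewrite ltr_pdivrMr//; lra.
  have m1 : (Num.truncn (10 / e)).+1%:R <= m%:R - 1 :> R.
    by rewrite lerBrDr natr1 ler_nat.
  have := le_trans (ltW (truncnS_gt (10 / e))) m1.
  have m10 : 0 < m%:R - 1 :> R by rewrite subr_gt0 ltr1n; lia.
  rewrite ler_pdivrMr// => h; rewrite ler_pdivrMr//; lra.
pose l : R := limn (series v).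
exists (expR l); first exact: expR_gt0.
have -> : (fun N => \prod_(0 <= p < N.+1 | prime p && odd p) h1_factor R p) =
    (fun N => expR (series v N.+1)).
  apply/funext => N; rewrite /series/= expR_sum big_mkcond/=.
  apply: eq_big_nat => p _; rewrite /v; case: ifP => [/andP[pp op]|_]; last by rewrite expR0.
  by rewrite lnK ?posrE// h1_factor_gt0// odd_prime_gt2.
apply: (@continuous_cvg _ _ _ _ _ (fun N => series v N.+1) expR l).
  exact: continuous_expR.
by rewrite (cvg_shiftS (series v)); exact: cv.
Qed.

(** * Roots of (aX + b)^2 + 1 modulo primes *)

Definition sq_form (a b : nat) : {poly int} :=
  ((a%:Z)%:P * 'X + (b%:Z)%:P) ^+ 2 + 1.

Lemma sq_form_eval (a b x : nat) :
  (sq_form a b).[x%:Z] = ((a * x + b) ^ 2 + 1)%N%:Z.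
Proof.
by rewrite /sq_form !hornerE /= PoszD -!natz natrX !natrD natrM !natz.
Qed.

Lemma quadratic_form_sq_form (a b : nat) : (0 < a)%N ->
  quadratic_form (sq_form a b).
Proof.
move=> a0; rewrite /quadratic_form /sq_form.
have sz : size ((a%:Z)%:P * 'X + (b%:Z)%:P) = 2%N.
  by rewrite size_MXaddC size_polyC polyC_eq0 eqz_nat gtn_eqF// eqz_nat gtn_eqF.
have sz2 : size (((a%:Z)%:P * 'X + (b%:Z)%:P) ^+ 2) = 3%N.
  have := size_exp ((a%:Z)%:P * 'X + (b%:Z)%:P) 2; rewrite sz /=.
  by case: (size _) => //= n ->.
by rewrite size_polyDl sz2// size_poly1.
Qed.

Lemma root_sq_form (F : fieldType) (a b : nat) (x : F) :
  root (map_poly intr (sq_form a b)) x = ((a%:R * x + b%:R) ^+ 2 == -1).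
Proof.
rewrite /root /sq_form rmorphD rmorphXn/= rmorphD rmorphM/= !map_polyC map_polyX /=.
by rewrite rmorph1 !hornerE/= addr_eq0.
Qed.

Lemma Fp_fermat (p : nat) (x : 'F_p) : prime p -> x != 0 -> x ^+ p.-1 = 1.
Proof.
move=> pp x0; apply: (mulfI x0); rewrite -exprS prednK ?prime_gt0// mulr1.
by have := expf_card x; rewrite card_Fp.
Qed.

(** If no [x] had [x ^ ((p - 1) / 2) = -1], then by Fermat's theorem all the [p - 1]
    nonzero elements would be roots of [X ^ ((p - 1) / 2) - 1], more than its
    degree allows.  As [(p - 1) / 2] is even, such an [x] has a power of square -1. *)
Lemma exists_sqrtN1 (p : nat) : prime p -> (p %% 4 == 1)%N ->
  exists x : 'F_p, x ^+ 2 = -1.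
Proof.
move=> pp p4; pose h := (p %/ 4).*2.
have p1 : (p.-1 = h * 2)%N by rewrite /h; lia.
have h0 : (0 < h)%N by have := prime_gt1 pp; rewrite /h; lia.
have [[x hx]|no] := pselect (exists x : 'F_p, x ^+ h = -1).
  by exists (x ^+ (p %/ 4)); rewrite -exprM muln2.
exfalso.
have all1 : all h.-unity_root (enum (predC1 (0 : 'F_p))).
  apply/allP => x; rewrite mem_enum inE => x0; rewrite unity_rootE.
  have := Fp_fermat pp x0; rewrite p1 exprM => /eqP; rewrite sqrf_eq1 => /orP[//|/eqP xh].
  by case: no; exists x.
have := max_unity_roots h0 all1 (enum_uniq _).
rewrite -cardE; have := cardC1 (0 : 'F_p); rewrite card_Fp// => ->.
by lia.
Qed.

Lemma card_sqrtN1 (p : nat) : prime p -> odd p ->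
  #|[pred x : 'F_p | x ^+ 2 == -1]| = if (p %% 4 == 1)%N then 2%N else 0%N.
Proof.
move=> pp op; have p2 := odd_prime_gt2 op pp.
have two0 : (2%:R : 'F_p) != 0.
  by rewrite -(dvdn_pcharf (pchar_Fp pp)) gtnNdvd.
case: ifP => p4.
  have [i hi] := exists_sqrtN1 pp p4.
  have i0 : i != 0.
    by apply/eqP => i0; move: hi; rewrite i0 expr0n/= => /esym/eqP; rewrite oppr_eq0 oner_eq0.
  have iNi : i != - i by rewrite -subr_eq0 opprK -mulr2n -mulr_natl mulf_neq0.
  transitivity #|pred2 i (- i)|; last by rewrite card2 iNi.
  by apply: eq_card => x; rewrite [LHS]inE -hi eqf_sqr !inE.
apply: eq_card0 => x; rewrite !inE; apply/negP => /eqP hx.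
have x0 : x != 0.
  by apply/eqP => x0; move: hx; rewrite x0 expr0n/= => /esym/eqP; rewrite oppr_eq0 oner_eq0.
have p1 : (p.-1 = 2 * (p %/ 4).*2.+1)%N by lia.
have := Fp_fermat pp x0; rewrite p1 exprM hx -signr_odd /= odd_double expr1 => /eqP.
by rewrite eq_sym -subr_eq0 opprK -[1 + 1]/(2%:R) (negPf two0).
Qed.

(** The substitution [x |-> a x + b] is then a bijection of ['F_p]. *)
Lemma nroots_sq_form_coprime (p a b : nat) : prime p -> odd p ->
  ~~ (p %| a)%N ->
  nroots_mod p (sq_form a b) = if (p %% 4 == 1)%N then 2%N else 0%N.
Proof.
move=> pp op pa; rewrite -card_sqrtN1// /nroots_mod.
have a0 : (a%:R : 'F_p) != 0 by rewrite -(dvdn_pcharf (pchar_Fp pp)).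
pose g (x : 'F_p) := (x - b%:R) / a%:R.
have gK : cancel g (fun x => a%:R * x + b%:R).
  by move=> x; rewrite /g mulrC divfK// subrK.
rewrite -[RHS](fintype.card_image (can_inj gK)); apply: eq_card => x.
rewrite [LHS]inE/= root_sq_form; apply/idP/fintype.imageP => [h|[y hy ->]].
  by exists (a%:R * x + b%:R); rewrite ?inE// /g addrK mulrC mulKf.
by rewrite gK.
Qed.

Lemma nroots_sq_form_dvd (p a b : nat) : prime p ->
  (p %| a)%N -> (p %| b)%N -> nroots_mod p (sq_form a b) = 0%N.
Proof.
move=> pp; rewrite !(dvdn_pcharf (pchar_Fp pp)) => /eqP a0 /eqP b0.
apply: eq_card0 => x; rewrite inE root_sq_form a0 b0 mul0r addr0 expr0n/=.
by rewrite eq_sym oppr_eq0 oner_eq0.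
Qed.

Lemma h1_poly_sq_form : (2%:P * 'X) ^+ 2 + 1 = sq_form 2 0.
Proof. by rewrite /sq_form addr0. Qed.

(** * Approximation by products of local corrections *)

(** Take the first product exceeding [y]: the previous one was at most [y], and
    the last factor is at most [1 + d]. *)
Lemma greedy_product (R : realFieldType) (r : nat -> R) (K : nat) (y d : R) :
  1 <= y -> (forall k, (K <= k)%N -> 1 <= r k <= 1 + d) ->
  (exists n, y < \prod_(K <= k < n) r k) ->
  exists2 n, (K <= n)%N & y < \prod_(K <= k < n) r k <= y * (1 + d).
Proof.
move=> y1 hr ex; case: (ex_minnP ex) => n yn nmin.
have Kn : (K < n)%N.
  by rewrite ltnNge; apply/negP => nK; move: yn; rewrite big_geq// ltNge y1.
exists n; first exact: ltnW.
rewrite yn /=; case: n => // n in yn nmin Kn *.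
rewrite big_nat_recr//=; have /andP[r1 r2] := hr n Kn.
apply: ler_pM => //; last by rewrite leNgt; apply/negP => /nmin; rewrite ltnn.
  by rewrite big_nat_cond prodr_ge0// => k /andP[/andP[/hr/andP[? _] _] _];
     apply: le_trans ler01 _.
exact: le_trans ler01 _.
Qed.

(** For a prime [p] equal to 1 modulo 4 this is [p / (p - 2)], the quotient of the
    factor [p / (p - 1)] of a form without roots modulo [p] by [h1_factor p]. *)
Definition boost (R : realType) (p : nat) : R :=
  if prime p && (p %% 4 == 1)%N then 1 + 2 / (p%:R - 2) else 1.

Lemma boost_ge1 (R : realType) (p : nat) : (3 <= p)%N -> 1 <= boost R p.
Proof.
move=> p3; have p3R : 3 <= p%:R :> R by rewrite ler_nat.
by rewrite /boost; case: ifP => // _; rewrite lerDl divr_ge0//; lra.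
Qed.

Lemma boost_product_unbounded (R : realType) (K : nat) (A : R) : (5 <= K)%N ->
  exists n, A < \prod_(K <= p < n) boost R p.
Proof.
move=> K5; have [n Kn hn] := sum_inv_prime_1mod4_unbounded A K5.
exists n; apply: le_lt_trans hn _.
suff [] : 1 <= \prod_(K <= p < n) boost R p /\
  \sum_(K <= p < n | prime p && (p %% 4 == 1)%N) p%:R^-1
    < \prod_(K <= p < n) boost R p by [].
elim: n {Kn} => [|n IH]; first by rewrite !big_geq.
have [nK|Kn] := ltnP n K; first by rewrite !big_geq.
have n3 : (3 <= n)%N by lia.
have n3R : 3 <= n%:R :> R by rewrite ler_nat.
have -> : \sum_(K <= p < n.+1 | prime p && (p %% 4 == 1)%N) p%:R^-1 =
    \sum_(K <= p < n | prime p && (p %% 4 == 1)%N) p%:R^-1 +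
    (if prime n && (n %% 4 == 1)%N then n%:R^-1 else 0) :> R.
  by rewrite big_mkcond big_nat_recr//= -big_mkcond.
rewrite big_nat_recr//=.
move: IH; set P := bigop _ _ _; set S := bigop _ _ _ => -[P1 SP].
split.
  apply: (le_trans P1); rewrite ler_peMr ?boost_ge1//.
  exact: le_trans ler01 P1.
rewrite /boost; case: ifP => _; last by rewrite addr0 mulr1.
have : n%:R^-1 <= 2 / (n%:R - 2) :> R.
  by rewrite ler_pdivlMr ?ler_pdivrMl; lra.
have : 0 < n%:R^-1 :> R by rewrite invr_gt0; lra.
by nra.
Qed.

Definition prime_block (K n : nat) : nat :=
  \prod_(K <= p < n | prime p && (p %% 4 == 1)%N) p.

Lemma prime_block_dvd (K n p : nat) : prime p ->
  (p %| prime_block K n)%N = (K <= p < n)%N && (p %% 4 == 1)%N.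
Proof.
move=> pp; rewrite /prime_block Euclid_dvd_prod// big_has_cond.
apply/hasP/idP => [[q]|/andP[Kpn p4]].
  rewrite mem_index_iota /= => Kqn /andP[/andP[pq q4]].
  by rewrite dvdn_prime2// => /eqP->; rewrite Kqn.
by exists p; rewrite ?mem_index_iota//= pp p4 dvdnn.
Qed.

Lemma h1_factorE (R : realType) (p : nat) : prime p -> odd p ->
  (p%:R - (if (p %% 4 == 1)%N then 2%N else 0%N)%:R) / (p%:R - 1) =
    h1_factor R p.
Proof.
move=> pp op; have p3 := odd_prime_gt2 op pp.
have p3R : 3 <= p%:R :> R by rewrite ler_nat.
have p10 : p%:R - 1 != 0 :> R by apply/eqP; lra.
by rewrite /h1_factor chi4_odd//; case: ifP => _; field; rewrite p10.
Qed.

Lemma boostE (R : realType) (p : nat) : prime p -> (p %% 4 == 1)%N ->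
  p%:R / (p%:R - 1) = h1_factor R p * boost R p.
Proof.
move=> pp p4; have op : odd p by lia.
have p3 := odd_prime_gt2 op pp; have p3R : 3 <= p%:R :> R by rewrite ler_nat.
have p10 : p%:R - 1 != 0 :> R by apply/eqP; lra.
have p20 : p%:R - 2 != 0 :> R by apply/eqP; lra.
by rewrite /h1_factor chi4_odd// /boost pp p4 /=; field; rewrite ?p10 ?p20.
Qed.

(** Modulo an odd prime dividing the block the form is constant, and elsewhere it
    has as many roots as [X^2 + 1]; the powers of 2 are invisible to odd primes. *)
Lemma h_partial_sq_form (R : realType) (K n k N : nat) : (n <= N.+1)%N ->
  (K <= n)%N ->
  h_partial R (sq_form (prime_block K n * 2 ^ k.+1) (prime_block K n * 2 ^ k)) N
  = (\prod_(0 <= p < N.+1 | prime p && odd p) h1_factor R p) *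
    \prod_(K <= p < n) boost R p.
Proof.
move=> nN Kn; pose m := prime_block K n.
have -> : \prod_(K <= p < n) boost R p =
    \prod_(0 <= p < N.+1) (if prime p && (p %| m)%N then boost R p else 1).
  rewrite (@big_cat_nat _ _ _ n 0 N.+1)//= (@big_cat_nat _ _ _ K 0 n)//=.
  rewrite [X in _ = X * _ * _]big_nat_cond [X in _ = X * _ * _]big1 => [|p]; last first.
    rewrite andbT => /andP[_ pK]; case: ifP => // /andP[pp].
    by rewrite prime_block_dvd// leqNgt pK.
  rewrite [X in _ = _ * X]big_nat_cond [X in _ = _ * X]big1 => [|p]; last first.
    rewrite andbT => /andP[np _]; case: ifP => // /andP[pp].
    by rewrite prime_block_dvd// [(p < n)%N]ltnNge np andbF.
  rewrite mul1r mulr1; apply: eq_big_nat => p Kpn.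
  case: ifP => // /negbT; rewrite negb_and /boost.
  by case: (boolP (prime p)) => //= pp; rewrite prime_block_dvd// Kpn /= => /negPf->.
rewrite /h_partial -(big_mkord (fun p => prime p && odd p) (fun p =>
  (p%:R - (nroots_mod p _)%:R) / (p%:R - 1))).
rewrite !(big_mkcond (fun p => prime p && odd p)) -big_split/=.
apply: eq_big_nat => p _; case: ifP => [/andP[pp op]|]/=; last first.
  case: (boolP (prime p)) => /= [pp op|_ _]; rewrite mul1r// prime_block_dvd//.
  by case: ifP => // /andP[_ p4]; lia.
rewrite pp /=.
have p2 k' : (p %| m * 2 ^ k')%N = (p %| m)%N.
  rewrite Euclid_dvdM// Euclid_dvdX// [(p %| 2)%N]dvdn_prime2//.
  by case: eqVneq op => [->|_ _] //; rewrite orbF.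
case: ifP => pm; last first.
  by rewrite nroots_sq_form_coprime ?p2 ?pm// h1_factorE// mulr1.
rewrite nroots_sq_form_dvd ?p2// subr0 boostE//.
by move: pm; rewrite prime_block_dvd// => /andP[].
Qed.

Lemma h_partial_sq_form20 (R : realType) (N : nat) :
  h_partial R (sq_form 2 0) N =
  \prod_(0 <= p < N.+1 | prime p && odd p) h1_factor R p.
Proof.
have := @h_partial_sq_form R 0 0 0 N isT isT.
rewrite /prime_block !(@big_geq _ _ _ 0 0)// !mul1n expn1 expn0 mulr1 => <-.
rewrite /h_partial; apply: eq_bigr => p /andP[pp op].
have p2 : ~~ (p %| 2)%N by rewrite dvdn_prime2//; apply/eqP => p2; rewrite p2 in op.
by rewrite !nroots_sq_form_coprime.
Qed.

(** * The sequence of forms *)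

(** A term is [y^2 + 1] with [y = m 2^k (2x + 1)], and the 2-adic valuation of [y]
    determines [k]. *)
Lemma terms_sq_form_disjoint (m : nat) : (0 < m)%N ->
  trivIset [set: nat] (fun k => terms (sq_form (m * 2 ^ k.+1) (m * 2 ^ k))).
Proof.
move=> m0 i j _ _ [_ [[x _ <-] [y _]]] /esym.
have E k z : (m * 2 ^ k.+1 * z + m * 2 ^ k = m * 2 ^ k * z.*2.+1)%N.
  by rewrite expnS; nia.
rewrite !sq_form_eval => -[]; rewrite !addn1 => -[] /eqP.
rewrite eqn_exp2r// !E => /eqP /(congr1 (logn 2)).
have L k z : logn 2 (m * 2 ^ k * z.*2.+1) = (logn 2 m + k)%N.
  rewrite !lognM ?muln_gt0 ?m0 ?expn_gt0// pfactorK//.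
  by rewrite [X in (_ + X)%N]logn_coprime ?addn0// coprime2n /= odd_double.
by rewrite !L => /addnI.
Qed.

Theorem theorem3 (R : realType) (h eps : R) (hh : h1 R <= h) (heps : 0 < eps) :
  exists (h' : R) (Q : nat -> {poly int}),
    [/\ `|h' - h| < eps,
        forall k : nat, quadratic_form (Q k),
        forall k : nat,
          cvgn (h_partial R (Q k)) /\ h_const R (Q k) = h'
      & trivIset [set: nat] (fun k : nat => terms (Q k))].
Proof.
have [L L0 cvL] := h1_product_cvg R.
have h1E : h1 R = L.
  rewrite /h1 /h_const h1_poly_sq_form; apply/cvg_lim => //.
  by rewrite (funext (h_partial_sq_form20 R)).
rewrite h1E in hh; have h0 : 0 < h by exact: lt_le_trans hh.
(* The limit will lie between [h] and [h * (1 + d) = h + eps / 2]. *)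
pose d := eps / (2 * h); have d0 : 0 < d by rewrite divr_gt0// mulr_gt0.
(* From [2 / d + 2] on, the correction [1 + 2 / (p - 2)] is at most [1 + d]. *)
pose K := maxn 5 (Num.truncn (2 / d)).+3.
have boostK k : (K <= k)%N -> 1 <= boost R k <= 1 + d.
  rewrite geq_max => /andP[k5 kd]; rewrite boost_ge1; last by lia.
  rewrite /boost; case: ifP => _; last by rewrite lerDl ltW.
  have k5R : 5 <= k%:R :> R by rewrite ler_nat.
  rewrite lerD2l ler_pdivrMr; last by lra.
  rewrite mulrC -ler_pdivrMr// lerBrDr; apply: le_trans (_ : (Num.truncn (2 / d)).+3%:R <= _).
    by rewrite -[_.+3]addn2 natrD lerD2r ltW// truncnS_gt.
  by rewrite ler_nat.
have y1 : 1 <= h / L by rewrite ler_pdivlMr// mul1r.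
have [|n Kn /andP[Ph Phd]] := greedy_product y1 boostK.
  by apply: boost_product_unbounded; rewrite leq_maxl.
set P := \prod_(_ <= _ < _) _ in Ph Phd.
pose m := prime_block K n.
have m0 : (0 < m)%N.
  by rewrite /m /prime_block prodn_cond_gt0// => p /andP[/prime_gt0].
exists (L * P), (fun k => sq_form (m * 2 ^ k.+1) (m * 2 ^ k)); split.
- have lo : h < L * P by rewrite mulrC -ltr_pdivrMr.
  have hi : L * P <= h * (1 + d).
    by rewrite mulrC -ler_pdivlMr// mulrAC.
  have hd : h * d = eps / 2 by rewrite /d; field; rewrite gt_eqF.
  by rewrite gtr0_norm; lra.
- by move=> k; apply: quadratic_form_sq_form; rewrite muln_gt0 m0 expn_gt0.
- move=> k; have cvk : h_partial R (sq_form (m * 2 ^ k.+1) (m * 2 ^ k)) @ \oo --> L * P.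
    have cvP : (fun N => (\prod_(0 <= p < N.+1 | prime p && odd p) h1_factor R p) * P)
       @ \oo --> L * P by apply: cvgMr_tmp.
    apply: cvg_trans cvP; apply: near_eq_cvg; exists n => // N /= nN.
    by rewrite h_partial_sq_form// leqW.
  by split; [apply/cvg_ex; exists (L * P)|apply/cvg_lim].
- exact: terms_sq_form_disjoint.
Qed.
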